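(* Let $(X,d)$ be a complete metric space with $|X|\geq 3$ and let $T\colon X\to X$ be a continuous, asymptotically regular generalized $F$-Kannan type mapping. Then $T$ has a fixed point, and the number of fixed points of $T$ is at most two.
   Context: Let $\mathbb{R}^+=[0,\infty)$. Let $\mathcal{F}$ be the class of functions $F\colon \mathbb{R}^+\times\mathbb{R}^+\times\mathbb{R}^+\to\mathbb{R}^+$ such that (i) $F(0,0,0)=0$ and (ii) $F$ is continuous at $(0,0,0)$. For a metric space $(X,d)$ with $|X|\geq 3$, a mapping $T\colon X\to X$ is a generalized $F$-Kannan type mapping on $X$ if there exists $F\in\mathcal{F}$ such that the inequality $$d(Tx,Ty)+d(Ty,Tz)+d(Tx,Tz)\leq F(d(x,Tx),d(y,Ty),d(z,Tz))$$ holds for all three pairwise distinct points $x,y,z\in X$. A mapping $T\colon X\to X$ is asymptotically regular if $\lim_{n\to\infty} d(T^{n+1}(x),T^n(x))=0$ for all $x\in X$. *)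

(* Defs.v *)
From mathcomp Require Import all_boot all_order all_algebra.
From mathcomp Require Import all_classical all_reals.
From mathcomp Require Import topology normedtype sequences.

Set Implicit Arguments.
Unset Strict Implicit.
Unset Printing Implicit Defensive.

Import Order.TTheory GRing.Theory Num.Theory.
Import numFieldNormedType.Exports.

Local Open Scope classical_set_scope.
Local Open Scope ring_scope.

Definition octant (R : realType) : set (R * R * R) :=
  [set p | [/\ 0 <= p.1.1, 0 <= p.1.2 & 0 <= p.2]].

(* A function from the octant to [0, +oo[ is represented by a total function on
   R^3 of which only the values on the octant are ever constrained or used; in
   particular, continuity at the origin is relative to the octant. *)
Definition class_F (R : realType) (F : R * R * R -> R) : Prop :=
  [/\ forall p, octant p -> 0 <= F p,
      F (0, 0, 0) = 0
    & F @ within (@octant R) (nbhs ((0, 0, 0) : R * R * R)) --> F (0, 0, 0)].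

Definition generalized_F_Kannan (R : realType) (X : metricType R)
    (T : X -> X) : Prop :=
  exists2 F : R * R * R -> R, class_F F &
    forall x y z : X, x != y -> y != z -> x != z ->
      mdist (T x) (T y) + mdist (T y) (T z) + mdist (T x) (T z)
        <= F (mdist x (T x), mdist y (T y), mdist z (T z)).

Definition asymptotically_regular (R : realType) (X : metricType R)
    (T : X -> X) : Prop :=
  forall x : X, mdist (iter n.+1 T x) (iter n T x) @[n --> \oo] --> (0 : R).

(* The library's completeType bundles a distinguished point, which metricType
   does not have; completeness is therefore stated with Cauchy sequences. *)
Definition complete_metric (R : realType) (X : metricType R) : Prop :=
  forall u : nat -> X, cauchy (u @ \oo) -> exists l : X, u @ \oo --> l.

(* Main.v *)
Require Import Defs.
From mathcomp Require Import all_boot all_order all_algebra.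
From mathcomp Require Import all_classical all_reals.
From mathcomp Require Import topology normedtype sequences.

Import Order.TTheory GRing.Theory Num.Theory.
Import numFieldNormedType.Exports.

Local Open Scope classical_set_scope.
Local Open Scope card_scope.
Local Open Scope ring_scope.

(** The Kannan inequality bounds distances between images by the displacements
    d(x, T x) alone, and F is small when all three displacements are small.
    Along an orbit of an asymptotically regular map the displacements tend to
    0, so the distance between any two late points of the orbit is small, as
    soon as a third late point is available and the three are distinct:
    the orbit is a Cauchy sequence, and by continuity its limit is fixed by T.
    The distinctness is harmless: an orbit that meets a point twice is
    eventually periodic, so it repeats one displacement forever, and
    asymptotic regularity forces this displacement to be 0, which already
    gives a fixed point ([orbit_injective]).

    For the bound on the number of fixed points, three distinct ones would have
    mutual distances whose sum is at most F(0, 0, 0) = 0. *)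

(** The form in which continuity at the origin is used: with displacements as
    the three arguments, the octant condition is automatic and only upper
    bounds have to be checked. *)
Lemma class_F_small {R : realType} {F : R * R * R -> R} :
  class_F F -> forall e : R, 0 < e -> exists2 delta : R, 0 < delta &
    forall a b c : R, 0 <= a < delta -> 0 <= b < delta -> 0 <= c < delta ->
      F (a, b, c) < e.
Proof.
case=> F_ge0 F0 /cvgrPdist_lt Fcont e e0.
have /nbhs_ballP[delta /= delta0 Fdelta] := Fcont e e0.
exists delta => // a b c /andP[a0 ad] /andP[b0 bd] /andP[c0 cd].
have oct : octant (a, b, c) by [].
have /= := Fdelta (a, b, c) _ oct.
rewrite F0 sub0r normrN ger0_norm ?F_ge0//; apply.
by split => //=; [split => //=|]; rewrite /ball/= sub0r normrN ger0_norm.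
Qed.

(** If the orbit returned to the same point after p > 0 steps, it would be
    periodic from there on and the displacement of that point would recur
    arbitrarily late, although displacements tend to 0. *)
Lemma orbit_injective {R : realType} {X : metricType R} {T : X -> X} {x : X} :
  (mdist (iter n.+1 T x) (iter n T x) @[n --> \oo] --> (0 : R)) ->
  (forall y, T y != y) -> injective (fun n => iter n T x).
Proof.
move=> reg nofix.
suff lt_neq n p : iter (n + p.+1) T x != iter n T x.
  move=> m n /= mn; have [lt|lt|//] := ltngtP m n.
  - by have := lt_neq m (n - m.+1)%N; rewrite addnS -addSn subnKC// mn eqxx.
  - by have := lt_neq n (m - n.+1)%N; rewrite addnS -addSn subnKC// mn eqxx.
apply/eqP => per.
have perk k : iter (n + k * p.+1) T x = iter n T x.
  elim: k => [|k IHk]; first by rewrite addn0.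
  by rewrite mulSn addnCA iterD IHk -iterD addnC.
have d0 : 0 < mdist (T (iter n T x)) (iter n T x) by rewrite mdist_gt0.
move/cvgrPdist_lt : reg => /(_ _ d0)[N _ /(_ (n + N * p.+1)%N)] /=.
rewrite perk sub0r normrN ger0_norm ?mdist_ge0// ltxx => H.
suff : false by [].
by apply: H; rewrite mulnS addnCA leq_addr.
Qed.

(** The third point required by the Kannan inequality is the successor of the
    later of the two orbit points being compared. *)
Lemma orbit_cauchy {R : realType} {X : metricType R} {T : X -> X} {x : X} :
  (mdist (iter n.+1 T x) (iter n T x) @[n --> \oo] --> (0 : R)) ->
  generalized_F_Kannan T -> injective (fun n => iter n T x) ->
  cauchy ((fun n => iter n T x) @ \oo).
Proof.
move=> reg [F clF kannan] inj; apply: cauchy_exP => e e0.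
have [delta delta0 Fdelta] := class_F_small clF _ e0.
have [N _ small] := (cvgrPdist_lt _ _).1 reg _ delta0.
have disp n : (N <= n)%N ->
    0 <= mdist (iter n T x) (T (iter n T x)) < delta.
  move=> /small /=.
  by rewrite sub0r normrN ger0_norm ?mdist_ge0// metric_sym.
have neq i j : (i < j)%N -> iter i T x != iter j T x.
  by move=> ij; apply/eqP => /inj ij'; rewrite ij' ltnn in ij.
exists (iter N.+1 T x), N.+1 => // -[//|m] /= /[!ltnS] Nm.
rewrite ballEmdist /=.
move: Nm; rewrite leq_eqVlt => /predU1P[<-|Nm]; first by rewrite mdistxx.
have Nm1 := ltnW Nm.
have := kannan _ _ _ (neq _ _ Nm) (neq _ _ (ltnSn m)) (neq _ _ (leqW Nm)).
rewrite -!iterS => le_F.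
apply: le_lt_trans (Fdelta _ _ _ (disp _ (leqnn N)) (disp _ Nm1)
  (disp _ (leqW Nm1))).
apply: le_trans le_F.
by rewrite -addrA lerDl addr_ge0// mdist_ge0.
Qed.

Lemma card_le_two {U : choiceType} (A : set U) :
  (forall x y z, A x -> A y -> A z -> x != y -> y != z -> x != z -> False) ->
  A #<= `I_2.
Proof.
move=> no3; have [->|/set0P[a Aa]] := eqVneq A set0; first exact: card_ge0.
(* At most one point of A differs from a, so testing against a separates A. *)
apply/pcard_leP/injfunPex; exists (fun x => (x != a) : nat) => [x _|x y].
  by rewrite /=; case: eqP.
rewrite !inE => Ax Ay; have [->|xa] := eqVneq x a; have [->|ya] := eqVneq y a => //.
move=> _; apply/eqP/negPn/negP => xy.
by apply: (no3 x y a).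
Qed.

Theorem theorem4p5 (R : realType) (X : metricType R) (T : X -> X)
  (hX : complete_metric X) (hcard : `I_3 #<= [set: X])
  (hT : continuous T) (hreg : asymptotically_regular T)
  (hF : generalized_F_Kannan T) :
  (exists x : X, T x = x) /\ ([set x : X | T x = x] #<= `I_2).
Proof.
split.
  have [x0 _] : exists x : X, [set: X] x.
    apply/set0P/negP => /eqP X0; move: hcard.
    by rewrite X0 card_le0 => /eqP/seteqP[/(_ 0%N)] /(_ isT).
  apply: contrapT => nofix.
  have nofixb y : T y != y by apply/eqP => Ty; apply: nofix; exists y.
  have inj := orbit_injective (hreg x0) nofixb.
  have [l cvl] := hX _ (orbit_cauchy (hreg x0) hF inj).
  apply: nofix; exists l.
  have cvT : (fun n => iter n.+1 T x0) @ \oo --> T l.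
    exact: cvg_comp cvl (hT l).
  apply: (cvg_unique (@metric_hausdorff _ X) cvT).
  have : (fun n => iter (n + 1) T x0) @ \oo --> l.
    exact: cvg_comp (cvg_addnr 1%N) cvl.
  by under eq_fun do rewrite addn1.
have [F [_ F0 _] kannan] := hF.
apply: card_le_two => x y z /= Tx Ty Tz xy yz xz.
have := kannan x y z xy yz xz.
rewrite Tx Ty Tz !mdistxx F0 leNgt => /negP; apply.
by rewrite !addr_gt0 ?mdist_gt0.
Qed.
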